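(* For every $n\ge 1$ there exists a finitely generated, torsion-free subgroup $\Gamma<\mathcal{G}^0(n)$ that cannot be realized by homeomorphisms, i.e. there is no homomorphism $\phi:\Gamma\to\mathrm{Homeo}(\mathbb{R}^n,0)$ such that for every $\gamma\in\Gamma$ the germ of $\phi(\gamma)$ at $0$ equals $\gamma$. Moreover, $\Gamma$ can be chosen to consist of germs of $C^\infty$ diffeomorphisms (i.e. inside $\mathcal{G}^\infty(n)$).
   Context: $\mathrm{Homeo}(\mathbb{R}^n,0)$ (resp. $\mathrm{Diff}^r(\mathbb{R}^n,0)$) denotes the group of orientation-preserving homeomorphisms (resp. $C^r$ diffeomorphisms) of $\mathbb{R}^n$ fixing the origin. $\mathcal{G}^r(n)$ denotes the group of germs at $0$ of elements of $\mathrm{Diff}^r(\mathbb{R}^n,0)$, i.e. the quotient of $\mathrm{Diff}^r(\mathbb{R}^n,0)$ by the normal subgroup of elements that restrict to the identity on some neighborhood of $0$; $\mathcal{G}^0(n)$ is the case of homeomorphisms. *)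

(* Defs.v *)
From Stdlib Require Import Reals Lra List.
Open Scope R_scope.

Definition Rn (n : nat) : Type := {i : nat | (i < n)%nat} -> R.

Definition origin (n : nat) : Rn n := fun _ => 0.

Definition near0 {n : nat} (eps : R) (x : Rn n) : Prop :=
  forall i, Rabs (x i) < eps.

Definition germ_eq {n : nat} (f g : Rn n -> Rn n) : Prop :=
  exists eps, 0 < eps /\ forall x, near0 eps x -> f x = g x.

Definition contR {n : nat} (u : Rn n -> R) : Prop :=
  forall (x : Rn n) eps, 0 < eps -> exists d, 0 < d /\
    forall y : Rn n, (forall i, Rabs (y i - x i) < d) -> Rabs (u y - u x) < eps.

Definition cont {n : nat} (f : Rn n -> Rn n) : Prop :=
  forall i, contR (fun x => f x i).

Definition is_homeo0 {n : nat} (f : Rn n -> Rn n) : Prop :=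
  exists g : Rn n -> Rn n,
    (forall x, g (f x) = x) /\ (forall y, f (g y) = y) /\
    cont f /\ cont g /\ f (origin n) = origin n.

Definition basis (n j : nat) : Rn n :=
  fun k => if Nat.eq_dec (proj1_sig k) j then 1 else 0.

Definition is_partial {n : nat} (u : Rn n -> R) (j : nat) (du : Rn n -> R) : Prop :=
  forall x : Rn n,
    derivable_pt_lim (fun t => u (fun k => x k + t * basis n j k)) 0 (du x).

Fixpoint Ck {n : nat} (k : nat) (u : Rn n -> R) : Prop :=
  match k with
  | O => contR u
  | S k' => contR u /\
      forall j, (j < n)%nat -> exists du, is_partial u j du /\ Ck k' du
  end.

Definition smoothR {n : nat} (u : Rn n -> R) : Prop := forall k, Ck k u.

Definition smooth {n : nat} (f : Rn n -> Rn n) : Prop :=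
  forall i, smoothR (fun x => f x i).

Definition minor (A : nat -> nat -> R) (j : nat) : nat -> nat -> R :=
  fun i k => A (S i) (if Nat.ltb k j then k else S k).

Fixpoint det (m : nat) (A : nat -> nat -> R) : R :=
  match m with
  | O => 1
  | S m' => sum_f_R0 (fun j => (-1) ^ j * A 0%nat j * det m' (minor A j)) m'
  end.

Definition jacobian0 {n : nat} (f : Rn n -> Rn n) (J : nat -> nat -> R) : Prop :=
  forall i j (hi : (i < n)%nat), (j < n)%nat ->
    derivable_pt_lim (fun t => f (fun k => t * basis n j k) (exist _ i hi)) 0 (J i j).

Definition orient_pres0 {n : nat} (f : Rn n -> Rn n) : Prop :=
  exists J, jacobian0 f J /\ 0 < det n J.

Definition smooth_diffeo0 {n : nat} (f g : Rn n -> Rn n) : Prop :=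
  (forall x, g (f x) = x) /\ (forall y, f (g y) = y) /\
  smooth f /\ smooth g /\ f (origin n) = origin n /\ orient_pres0 f.

(** Words in a finite list of generators (index, inverted?) *)
Definition word := list (nat * bool).

Definition letter {n : nat} (gens : list ((Rn n -> Rn n) * (Rn n -> Rn n)))
  (a : nat * bool) : Rn n -> Rn n :=
  let p := nth (fst a) gens ((fun x => x), (fun x => x)) in
  if snd a then snd p else fst p.

(** eval (w1 ++ w2) = eval w1 o eval w2 *)
Fixpoint eval {n : nat} (gens : list ((Rn n -> Rn n) * (Rn n -> Rn n)))
  (w : word) : Rn n -> Rn n :=
  match w with
  | nil => fun x => x
  | a :: w' => fun x => letter gens a (eval gens w' x)
  end.

Fixpoint wpow (w : word) (m : nat) : word :=
  match m with O => nil | S m' => w ++ wpow w m' end.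

(** The subgroup Gamma of germs generated by the germs of gens is the set of
    words modulo germ equality.  It is torsion-free: *)
Definition torsion_free {n : nat} (gens : list ((Rn n -> Rn n) * (Rn n -> Rn n))) : Prop :=
  forall (w : word) (m : nat), (1 <= m)%nat ->
    germ_eq (eval gens (wpow w m)) (fun x => x) -> germ_eq (eval gens w) (fun x => x).

(** Gamma is realized by homeomorphisms: a homomorphism phi : Gamma -> Homeo(R^n,0)
    (a function on words constant on germ classes, multiplicative) such that
    the germ of phi(gamma) is gamma. *)
Definition realizable {n : nat} (gens : list ((Rn n -> Rn n) * (Rn n -> Rn n))) : Prop :=
  exists phi : word -> (Rn n -> Rn n),
    (forall w1 w2, germ_eq (eval gens w1) (eval gens w2) ->
       forall x, phi w1 x = phi w2 x) /\
    (forall w1 w2 x, phi (w1 ++ w2) x = phi w1 (phi w2 x)) /\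
    (forall w, is_homeo0 (phi w)) /\
    (forall w, germ_eq (phi w) (eval gens w)).

(* Main.v *)
(** The group acts on the first coordinate only and is generated by the
    contraction [b : t -> t / 2] and two diffeomorphisms [f] and [g] of the line
    that move points to the left exactly on the union of the intervals
    [(4, 6) / lam k], respectively [(5, 7) / lam k], with [lam k = 2 ^ (k * k)].
    For every [m >= 1] the supports of [f] and [b^m g b^-m] are disjoint near [0],
    because the gaps of the sequence [k * k] grow; hence [f] and [b^m g b^-m]
    commute as germs, on a neighborhood depending on [m]. In a realization they
    commute everywhere. But a realization agrees with [b], [b^-1], [f] and [g] on
    some fixed neighborhood of [0], and for [m = (k + 1)^2 - k^2] with [k] large
    the shifted support of [g] overlaps the support of [f] inside it: the fixed
    point [6 / lam (k + 1)] of [f] is moved by [b^m g b^-m] to a point which [f]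
    does not fix. Torsion-freeness holds since germs of increasing homeomorphisms
    of the line have no torsion. *)

From Stdlib Require Import Reals Factorial Lra Lia List.
From Stdlib Require Import FunctionalExtensionality ClassicalEpsilon.
From Coquelicot Require Import Coquelicot.
Require Import Defs.
Open Scope R_scope.

(** * Smooth functions of one variable *)

(** The derivatives are existential witnesses, so that closure properties become inductions on [k]
    which supply the derivative explicitly. *)
Fixpoint CkR (k : nat) (u : R -> R) : Prop :=
  match k with
  | O => forall x, continuous u x
  | S k' => exists du, (forall x, is_derive u x (du x)) /\ CkR k' du
  end.

Lemma CkR_continuous k u : CkR k u -> forall x, continuous u x.
Proof.
  destruct k as [|k]; simpl; [easy|].
  intros [du [Hd _]] x. apply (ex_derive_continuous (V := R_NormedModule) u x). now exists (du x).
Qed.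

Lemma CkR_pred k u : CkR (S k) u -> CkR k u.
Proof.
  revert u; induction k as [|k IH]; intros u H.
  - exact (CkR_continuous 1 u H).
  - destruct H as [du [Hd H]]. exists du; split; auto.
Qed.

Lemma CkR_ext k u v : (forall x, u x = v x) -> CkR k u -> CkR k v.
Proof.
  intros E H. replace v with u; auto. now apply functional_extensionality.
Qed.

Lemma CkR_const k c : CkR k (fun _ => c).
Proof.
  revert c; induction k as [|k IH]; intros c.
  - intros x. apply continuous_const.
  - exists (fun _ => 0); split; auto. intros x. apply (is_derive_const c x).
Qed.

Lemma CkR_id k : CkR k (fun x => x).
Proof.
  destruct k as [|k].
  - intros x. apply continuous_id.
  - exists (fun _ => 1); split; [|apply CkR_const]. intros x. apply (is_derive_id x).
Qed.

Lemma CkR_plus k u v : CkR k u -> CkR k v -> CkR k (fun x => u x + v x).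
Proof.
  revert u v; induction k as [|k IH]; intros u v Hu Hv.
  - intros x. apply (continuous_plus u v x); auto.
  - destruct Hu as [du [Du Hu]], Hv as [dv [Dv Hv]].
    exists (fun x => du x + dv x); split; auto.
    intros x. apply (is_derive_plus u v x); auto.
Qed.

Lemma CkR_mult k u v : CkR k u -> CkR k v -> CkR k (fun x => u x * v x).
Proof.
  revert u v; induction k as [|k IH]; intros u v Hu Hv.
  - intros x. apply (continuous_mult u v x); auto.
  - pose proof (CkR_pred _ _ Hu) as Hu0. pose proof (CkR_pred _ _ Hv) as Hv0.
    destruct Hu as [du [Du Hu]], Hv as [dv [Dv Hv]].
    exists (fun x => du x * v x + u x * dv x); split.
    + intros x. apply (is_derive_mult u v x); auto. exact Rmult_comm.
    + apply CkR_plus; auto.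
Qed.

Lemma CkR_comp k u v : CkR k u -> CkR k v -> CkR k (fun x => u (v x)).
Proof.
  revert u v; induction k as [|k IH]; intros u v Hu Hv.
  - intros x. apply (continuous_comp v u x); auto.
  - pose proof (CkR_pred _ _ Hv) as Hv0.
    destruct Hu as [du [Du Hu]], Hv as [dv [Dv Hv]].
    exists (fun x => dv x * du (v x)); split.
    + intros x. apply (is_derive_comp u v x); auto.
    + apply CkR_mult; auto.
Qed.

Lemma CkR_inv k u : (forall x, u x <> 0) -> CkR k u -> CkR k (fun x => / u x).
Proof.
  intros N; induction k as [|k IH]; intros Hu.
  - intros x. apply (continuous_comp u Rinv x); auto.
    apply (continuous_Rinv (u x)); auto.
  - pose proof (CkR_pred _ _ Hu) as Hu0.
    destruct Hu as [du [Du Hu]].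
    exists (fun x => (-1) * du x * (/ u x * / u x)); split.
    + intros x. replace (-1 * du x * (/ u x * / u x)) with (- du x / (u x) ^ 2)
        by (field; auto).
      apply (is_derive_inv u x); auto.
    + apply CkR_mult; [apply CkR_mult; [apply CkR_const|auto]|apply CkR_mult; auto].
Qed.

(** * Flat functions and bumps *)

(** The bound forces [u 0 = 0], and the difference quotient at 0 is at most [C * Rabs h]. This
    settles differentiability at 0, where [flat] and [spread] have no single formula. *)
Lemma is_derive_quadratic_bound (u : R -> R) C :
  (forall y, Rabs (u y) <= C * y ^ 2) -> is_derive u 0 0.
Proof.
  intros B. apply is_derive_Reals. intros eps He.
  assert (U0 : u 0 = 0).
  { specialize (B 0). replace (C * 0 ^ 2) with 0 in B by ring.
    destruct (Req_dec (u 0) 0) as [|N]; auto. apply Rabs_pos_lt in N. lra. }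
  assert (HC : 0 < Rabs C + 1) by (pose proof (Rabs_pos C); lra).
  assert (Hd : 0 < eps / (Rabs C + 1)) by (apply Rdiv_lt_0_compat; lra).
  exists (mkposreal _ Hd). intros h Hh Hl; simpl in Hl.
  rewrite U0, Rplus_0_l, !Rminus_0_r. unfold Rdiv; rewrite Rabs_mult, Rabs_inv.
  assert (P : 0 < Rabs h) by now apply Rabs_pos_lt.
  apply Rmult_lt_reg_r with (Rabs h); auto.
  rewrite Rmult_assoc, Rinv_l, Rmult_1_r by lra.
  specialize (B h). rewrite <- (pow2_abs h) in B.
  apply (Rmult_lt_compat_r (Rabs C + 1)) in Hl; auto.
  unfold Rdiv in Hl; rewrite Rmult_assoc, Rinv_l, Rmult_1_r in Hl by lra.
  pose proof (Rle_abs C). nra.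
Qed.

(** [y ^ p / p!] is one of the nonnegative terms of the series of [exp y]. *)
Lemma pow_mul_exp_opp_le y p : 0 <= y -> y ^ p * exp (- y) <= INR (fact p).
Proof.
  intros Hy.
  assert (T : y ^ p / INR (fact p) <= exp y).
  { eapply Rle_trans; [|apply (exp_ge_taylor y p Hy)].
    destruct p as [|p]; [apply Rle_refl|rewrite tech5].
    assert (0 <= sum_f_R0 (fun k => y ^ k / INR (fact k)) p); [|lra].
    apply cond_pos_sum. intros k. apply Rle_mult_inv_pos; [now apply pow_le|].
    apply INR_fact_lt_0. }
  pose proof (INR_fact_lt_0 p) as F. pose proof (exp_pos (- y)) as E.
  rewrite exp_Ropp. pose proof (exp_pos y).
  apply Rmult_le_reg_r with (exp y); auto.
  rewrite Rmult_assoc, Rinv_l, Rmult_1_r by lra.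
  apply (Rmult_le_compat_l (INR (fact p))) in T; [|lra].
  unfold Rdiv in T. rewrite (Rmult_comm (y ^ p)), <- Rmult_assoc, Rinv_r, Rmult_1_l in T by lra.
  lra.
Qed.

(* The powers of [/ x] make the family stable under differentiation. *)
Definition flat (m : nat) (x : R) : R :=
  if Rlt_dec 0 x then (/ x) ^ m * exp (- / x) else 0.

Lemma flat_pos m x : 0 < x -> 0 < flat m x.
Proof.
  intros H. unfold flat. destruct (Rlt_dec 0 x); [|lra].
  apply Rmult_lt_0_compat; [|apply exp_pos]. apply pow_lt. now apply Rinv_0_lt_compat.
Qed.

Lemma flat_npos m x : x <= 0 -> flat m x = 0.
Proof. intros H. unfold flat. destruct (Rlt_dec 0 x); lra. Qed.

(** The exponential bound at [y = / x] and [p = m + 2] leaves two spare powers of [/ x], which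
    become [x ^ 2]. *)
Lemma flat_le m x : Rabs (flat m x) <= INR (fact (m + 2)) * x ^ 2.
Proof.
  destruct (Rlt_dec 0 x) as [P|P].
  - rewrite Rabs_pos_eq by now apply Rlt_le, flat_pos.
    unfold flat. destruct (Rlt_dec 0 x); [|lra].
    assert (Q : 0 < / x) by now apply Rinv_0_lt_compat.
    pose proof (pow_mul_exp_opp_le (/ x) (m + 2) (Rlt_le _ _ Q)) as B.
    rewrite pow_add in B.
    apply (Rmult_le_compat_r (x ^ 2)) in B; [|apply pow2_ge_0].
    replace ((/ x) ^ m * (/ x) ^ 2 * exp (- / x) * x ^ 2)
      with ((/ x) ^ m * exp (- / x)) in B by (rewrite !pow_inv; field; split; [lra|apply pow_nonzero; lra]).
    exact B.
  - rewrite flat_npos, Rabs_R0 by lra.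
    apply Rmult_le_pos; [apply pos_INR|apply pow2_ge_0].
Qed.

Lemma is_derive_flat m x :
  is_derive (flat m) x (flat (m + 2) x - INR m * flat (m + 1) x).
Proof.
  destruct (Rtotal_order 0 x) as [P|[<-|P]].
  - apply (is_derive_ext_loc (fun y => (/ y) ^ m * exp (- / y))).
    + exists (mkposreal x P). intros y Hy.
      unfold ball in Hy; simpl in Hy; unfold AbsRing_ball, abs, minus, plus, opp in Hy; simpl in Hy.
      apply Rabs_def2 in Hy. unfold flat. destruct (Rlt_dec 0 y); lra.
    + unfold flat. destruct (Rlt_dec 0 x); [|lra].
      auto_derive; [lra|].
      destruct m as [|m]; [simpl; field; lra|].
      rewrite !pow_add. simpl Nat.pred. simpl pow. field. lra.
  - rewrite !flat_npos by lra. replace (0 - INR m * 0) with 0 by ring.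
    exact (is_derive_quadratic_bound _ _ (flat_le m)).
  - rewrite !flat_npos by lra. replace (0 - INR m * 0) with 0 by ring.
    apply (is_derive_ext_loc (fun _ => 0)); [|apply (is_derive_const 0 x)].
    assert (Q : 0 < - x) by lra.
    exists (mkposreal _ Q). intros y Hy.
    unfold ball in Hy; simpl in Hy; unfold AbsRing_ball, abs, minus, plus, opp in Hy; simpl in Hy.
    apply Rabs_def2 in Hy. rewrite flat_npos; lra.
Qed.

Lemma CkR_flat k m : CkR k (flat m).
Proof.
  revert m; induction k as [|k IH]; intros m.
  - intros x. apply (ex_derive_continuous (V := R_NormedModule) (flat m) x). eexists. apply is_derive_flat.
  - eexists; split; [apply is_derive_flat|].
    apply CkR_ext with (fun x => flat (m + 2) x + (- INR m) * flat (m + 1) x).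
    + intros x; ring.
    + apply CkR_plus; auto. apply CkR_mult; auto. apply CkR_const.
Qed.

Definition bump (a b x : R) : R := flat 0 (x - a) * flat 0 (b - x).

Lemma CkR_bump k a b : CkR k (bump a b).
Proof.
  apply CkR_mult.
  - apply (CkR_comp k (flat 0) (fun x => x + (- a))); [apply CkR_flat|].
    apply CkR_plus; [apply CkR_id|apply CkR_const].
  - apply CkR_ext with (fun x => flat 0 (b + (-1) * x)); [intros x; f_equal; ring|].
    apply (CkR_comp k (flat 0) (fun x => b + (-1) * x)); [apply CkR_flat|].
    apply CkR_plus; [apply CkR_const|apply CkR_mult; [apply CkR_const|apply CkR_id]].
Qed.

Lemma bump_pos a b x : a < x < b -> 0 < bump a b x.
Proof. intros H. apply Rmult_lt_0_compat; apply flat_pos; lra. Qed.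

Lemma bump_out a b x : x <= a \/ b <= x -> bump a b x = 0.
Proof.
  intros [H|H]; unfold bump.
  - rewrite (flat_npos _ (x - a)) by lra; ring.
  - rewrite (flat_npos _ (b - x)) by lra; ring.
Qed.

(** * Functions vanishing outside an interval *)

Definition vanishes_out (a b : R) (u : R -> R) : Prop :=
  forall x, x <= a \/ b <= x -> u x = 0.

Lemma continuous_continuity_pt (u : R -> R) x : continuous u x -> continuity_pt u x.
Proof. intros H. now apply continuity_pt_filterlim. Qed.

Lemma vanishes_out_bounded a b u : a <= b -> vanishes_out a b u ->
  (forall x, continuous u x) -> exists M, 0 <= M /\ forall x, Rabs (u x) <= M.
Proof.
  intros Hab V C.
  destruct (continuity_ab_maj (fun x => Rabs (u x)) a b Hab) as [p [Hp _]].
  { intros c _. apply continuous_continuity_pt.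
    apply (continuous_comp u Rabs c); [apply C|apply continuous_Rabs]. }
  exists (Rabs (u p)). split; [apply Rabs_pos|]. intros x.
  destruct (Rle_dec x a) as [H|H]; [|destruct (Rle_dec b x) as [H'|H']].
  - rewrite V, Rabs_R0 by auto. apply Rabs_pos.
  - rewrite V, Rabs_R0 by auto. apply Rabs_pos.
  - apply Hp; lra.
Qed.

(* A one-sided difference quotient already vanishes. *)
Lemma vanishes_out_derive a b u (du : R -> R) : a <= b -> vanishes_out a b u ->
  (forall x, is_derive u x (du x)) -> vanishes_out a b du.
Proof.
  intros Hab V D x Hx.
  destruct (Req_dec (du x) 0) as [|N]; auto. exfalso.
  apply Rabs_pos_lt in N.
  destruct (proj1 (is_derive_Reals _ _ _) (D x) _ N) as [[d Hd] Q]; simpl in Q.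
  destruct Hx as [Hx|Hx].
  - specialize (Q (- (d / 2))).
    rewrite (V (x + _)), (V x) in Q by (auto || left; lra).
    replace ((0 - 0) / - (d / 2) - du x) with (- du x) in Q by (field; lra).
    rewrite (Rabs_Ropp (du x)) in Q. apply (Rlt_irrefl (Rabs (du x))), Q; [lra|].
    rewrite Rabs_Ropp, Rabs_pos_eq; lra.
  - specialize (Q (d / 2)).
    rewrite (V (x + _)), (V x) in Q by (auto || right; lra).
    replace ((0 - 0) / (d / 2) - du x) with (- du x) in Q by (field; lra).
    rewrite (Rabs_Ropp (du x)) in Q. apply (Rlt_irrefl (Rabs (du x))), Q; [lra|].
    rewrite Rabs_pos_eq; lra.
Qed.

(** * Rescaled copies of a bump accumulating at 0 *)

Definition lam (k : nat) : R := 2 ^ (k * k).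

Lemma lam_pos k : 0 < lam k.
Proof. apply pow_lt; lra. Qed.

Lemma lam_ge_1 k : 1 <= lam k.
Proof. apply pow_R1_Rle; lra. Qed.

Lemma lam_double k l : (k < l)%nat -> 2 * lam k <= lam l.
Proof.
  intros H. unfold lam. change (2 * 2 ^ (k * k)) with (2 ^ S (k * k)).
  apply Rle_pow; [lra|nia].
Qed.

(** Distinct scales differ by a factor of at least 2, while [71 / 39 < 2]. The window is a little
    wider than [4, 7], so that it is an open set around the closed support. *)
Lemma lam_uniq k l x : 39 / 10 < lam k * x < 71 / 10 ->
  39 / 10 < lam l * x < 71 / 10 -> k = l.
Proof.
  assert (W : forall k l, (k < l)%nat -> 39 / 10 < lam k * x < 71 / 10 ->
    39 / 10 < lam l * x < 71 / 10 -> False).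
  { intros i j Hij Hi Hj. pose proof (lam_double i j Hij).
    pose proof (lam_pos i). assert (0 < x) by nra. nra. }
  intros Hk Hl. destruct (Nat.lt_trichotomy k l) as [C|[C|C]]; auto; exfalso; eauto.
Qed.

(* The function [sum_k exp (- lam k) * lam k ^ j * beta (lam k * x)] for [beta]
   supported in [4, 7]: its terms have disjoint supports, so that the only
   nonzero one can be selected. Differentiation turns [j, beta] into
   [S j, beta']. *)
Definition spread (j : nat) (beta : R -> R) (x : R) : R :=
  match excluded_middle_informative (exists k, 4 < lam k * x < 7) with
  | left e =>
      let k := proj1_sig (constructive_indefinite_description _ e) in
      exp (- lam k) * lam k ^ j * beta (lam k * x)
  | right _ => 0
  end.

(** Inside the support the selected index must be [k] by [lam_uniq]; in the margins of the window
    both sides vanish. *)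
Lemma spread_eq j beta k x : vanishes_out 4 7 beta -> 39 / 10 < lam k * x < 71 / 10 ->
  spread j beta x = exp (- lam k) * lam k ^ j * beta (lam k * x).
Proof.
  intros V H. unfold spread.
  destruct (excluded_middle_informative _) as [e|N].
  - destruct (constructive_indefinite_description _ e) as [l Hl]; simpl.
    rewrite (lam_uniq k l x); auto; lra.
  - rewrite V; [ring|]. destruct (Rle_dec (lam k * x) 4); auto.
    destruct (Rle_dec 7 (lam k * x)); auto. exfalso; apply N; exists k; lra.
Qed.

Lemma spread_0 j beta x : (forall k, ~ 4 < lam k * x < 7) -> spread j beta x = 0.
Proof.
  intros H. unfold spread.
  destruct (excluded_middle_informative _) as [[k e]|N]; auto. now destruct (H k).
Qed.

Lemma spread_npos j beta x : x <= 0 -> spread j beta x = 0.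
Proof.
  intros H. apply spread_0. intros k [L _]. pose proof (lam_pos k). nra.
Qed.

(** On the support at scale [k] one has [1 <= (lam k * x) ^ 2]. Inserting this factor gives [x ^ 2]
    times [exp (- lam k) * lam k ^ (j + 2)], which is bounded uniformly in [k]. *)
Lemma spread_le j beta : vanishes_out 4 7 beta -> (forall x, continuous beta x) ->
  exists C, forall x, Rabs (spread j beta x) <= C * x ^ 2.
Proof.
  intros V C. destruct (vanishes_out_bounded 4 7 beta) as [M [M0 HM]]; auto; [lra|].
  exists (INR (fact (j + 2)) * M). intros x.
  assert (F : 0 <= INR (fact (j + 2)) * M) by (apply Rmult_le_pos; [apply pos_INR|auto]).
  destruct (excluded_middle_informative (exists k, 4 < lam k * x < 7)) as [[k Hk]|N].
  - rewrite (spread_eq j beta k x) by (auto; lra).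
    pose proof (lam_pos k) as L. pose proof (exp_pos (- lam k)) as E.
    pose proof (pow_mul_exp_opp_le (lam k) (j + 2) (Rlt_le _ _ L)) as B.
    pose proof (pow_lt _ j L) as P.
    rewrite pow_add in B.
    rewrite Rabs_mult, Rabs_pos_eq by nra.
    assert (X : 1 <= lam k ^ 2 * x ^ 2).
    { rewrite <- Rpow_mult_distr. replace 1 with (1 ^ 2) by ring. apply pow_incr; lra. }
    assert (EP : 0 <= exp (- lam k) * lam k ^ j) by nra.
    apply Rle_trans with (exp (- lam k) * lam k ^ j * M).
    { apply Rmult_le_compat_l; auto. }
    assert (G : exp (- lam k) * lam k ^ j <= INR (fact (j + 2)) * x ^ 2).
    { apply Rle_trans with (exp (- lam k) * lam k ^ j * (lam k ^ 2 * x ^ 2)); [nra|].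
      apply (Rmult_le_compat_r (x ^ 2)) in B; [|apply pow2_ge_0]. nra. }
    apply (Rmult_le_compat_r M) in G; auto. nra.
  - rewrite spread_0, Rabs_R0 by (intros i Hi; apply N; now exists i).
    apply Rmult_le_pos; [auto|apply pow2_ge_0].
Qed.

Lemma locally_Rabs (x d : R) (P : R -> Prop) : 0 < d ->
  (forall y, Rabs (y - x) < d -> P y) -> locally x P.
Proof. intros Hd H. exists (mkposreal d Hd). intros y Hy. now apply H. Qed.

(** Away from 0 the supports are locally finite. The index [k] is chosen before [j] and [beta], so
    that one choice serves a function and its derivative. *)
Lemma spread_local x : x <> 0 ->
  (exists k, 39 / 10 < lam k * x < 71 / 10 /\
     forall j beta, vanishes_out 4 7 beta -> locally x (fun y =>
       exp (- lam k) * lam k ^ j * beta (lam k * y) = spread j beta y)) \/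
  (forall j beta, locally x (fun y => 0 = spread j beta y)).
Proof.
  intros Hx. destruct (Rlt_dec 0 x) as [P|P].
  - destruct (excluded_middle_informative
      (exists k, 39 / 10 < lam k * x < 71 / 10)) as [[k Hk]|N].
    + left. exists k. split; auto. intros j beta V. pose proof (lam_pos k) as L.
      assert (D : 0 < Rmin (lam k * x - 39 / 10) (71 / 10 - lam k * x) / lam k).
      { apply Rdiv_lt_0_compat; auto. apply Rmin_glb_lt; lra. }
      apply (locally_Rabs _ _ _ D). intros y Hy. symmetry. apply spread_eq; auto.
      apply (Rmult_lt_compat_r (lam k)) in Hy; auto.
      unfold Rdiv in Hy. rewrite Rmult_assoc, Rinv_l, Rmult_1_r in Hy by lra.
      pose proof (Rmin_l (lam k * x - 39 * / 10) (71 * / 10 - lam k * x)).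
      pose proof (Rmin_r (lam k * x - 39 * / 10) (71 * / 10 - lam k * x)).
      unfold Rabs in Hy; destruct (Rcase_abs (y - x)); nra.
    (* A relative error of 1/100 cannot carry a point of [4, 7] out of the wider window:
       [4 / 1.01 > 3.9] and [7 / 0.99 < 7.1]. *)
    + right. intros j beta. assert (D : 0 < x / 100) by lra.
      apply (locally_Rabs _ _ _ D). intros y Hy. symmetry. apply spread_0. intros k Hk.
      pose proof (lam_pos k). apply Rabs_def2 in Hy.
      apply N; exists k; split; nra.
  - right. intros j beta. assert (D : 0 < - x) by lra.
    apply (locally_Rabs _ _ _ D). intros y Hy. apply Rabs_def2 in Hy.
    symmetry; apply spread_npos; lra.
Qed.

(** At 0 the quadratic bound gives derivative 0. Elsewhere the local form is zero or a single term,
    whose chain-rule factor [lam k] raises [j] by one. *)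
Lemma is_derive_spread j beta (dbeta : R -> R) x : vanishes_out 4 7 beta ->
  (forall y, is_derive beta y (dbeta y)) ->
  is_derive (spread j beta) x (spread (S j) dbeta x).
Proof.
  intros V D.
  assert (V' : vanishes_out 4 7 dbeta) by (apply (vanishes_out_derive 4 7 beta); auto; lra).
  assert (C : forall y, continuous beta y).
  { intros y. apply (ex_derive_continuous (V := R_NormedModule) beta y). now exists (dbeta y). }
  destruct (Req_dec x 0) as [->|Hx].
  - rewrite spread_npos by lra. destruct (spread_le j beta V C) as [K HK].
    exact (is_derive_quadratic_bound _ _ HK).
  - destruct (spread_local x Hx) as [[k [Hk L]]|L].
    + apply (is_derive_ext_loc _ _ _ _ (L j beta V)).
      rewrite (spread_eq _ _ k) by auto.
      replace (exp (- lam k) * lam k ^ S j * dbeta (lam k * x))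
        with (exp (- lam k) * lam k ^ j * (lam k * dbeta (lam k * x))) by (simpl; ring).
      apply is_derive_scal.
      apply (is_derive_comp beta (fun y => lam k * y) x); auto.
      auto_derive; auto; ring.
    + rewrite <- (locally_singleton _ _ (L (S j) dbeta)).
      apply (is_derive_ext_loc _ _ _ _ (L j beta)). apply (is_derive_const 0 x).
Qed.

Lemma CkR_spread k j beta : CkR k beta -> vanishes_out 4 7 beta -> CkR k (spread j beta).
Proof.
  revert j beta; induction k as [|k IH]; intros j beta H V.
  - intros x. destruct (Req_dec x 0) as [->|Hx].
    + destruct (spread_le j beta V H) as [K HK].
      apply (ex_derive_continuous (V := R_NormedModule)). exists 0.
      exact (is_derive_quadratic_bound _ _ HK).
    + destruct (spread_local x Hx) as [[i [Hi L]]|L].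
      * apply (continuous_ext_loc _ _ _ (L j beta V)).
        apply (continuous_mult (fun _ => exp (- lam i) * lam i ^ j)).
        -- apply continuous_const.
        -- apply (continuous_comp (fun y => lam i * y) beta); [|apply H].
           apply (continuous_mult (fun _ => lam i)); [apply continuous_const|apply continuous_id].
      * apply (continuous_ext_loc _ _ _ (L j beta)). apply continuous_const.
  - destruct H as [db [D H]]. exists (spread (S j) db). split.
    + intros x. now apply is_derive_spread.
    + apply IH; auto. apply (vanishes_out_derive 4 7 beta); auto; lra.
Qed.

(** * Smooth diffeomorphisms of the line *)

Definition smooth_line (u : R -> R) : Prop := forall k, CkR k u.

Lemma increment_ge (F dF : R -> R) x y : (forall z, is_derive F z (dF z)) ->
  (forall z, / 2 <= dF z) -> x <= y -> (y - x) / 2 <= F y - F x.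
Proof.
  intros D B Hxy. destruct (MVT_gen F x y dF) as [c [_ ->]].
  - intros; apply D.
  - intros z _. apply continuous_continuity_pt.
    apply (ex_derive_continuous (V := R_NormedModule)). now exists (dF z).
  - specialize (B c). nra.
Qed.

(** The lower bound on [dF] makes [G] Lipschitz with constant 2, whence [G' = / dF (G y)]. This
    formula bootstraps: if [G] is of class [k], so is [G']. *)
Lemma smooth_line_inverse (F dF G : R -> R) :
  (forall x, is_derive F x (dF x)) -> smooth_line dF -> (forall x, / 2 <= dF x) ->
  (forall y, F (G y) = y) -> (forall x, G (F x) = x) -> smooth_line G.
Proof.
  intros D S B FG GF.
  assert (E : forall x y, x <= y -> (y - x) / 2 <= F y - F x)
    by (intros x y; now apply (increment_ge F dF)).
  assert (A : forall x y, Rabs (y - x) <= 2 * Rabs (F y - F x)).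
  { intros x y. destruct (Rle_dec x y) as [H|H].
    - pose proof (E x y H). rewrite !Rabs_pos_eq; lra.
    - pose proof (E y x ltac:(lra)). rewrite !Rabs_left1; lra. }
  assert (DG : forall y, is_derive G y (/ dF (G y))).
  { intros y. apply is_derive_Reals. intros eps He.
    (* The slopes [q] and [l] are at least 1/2, so passing to inverses multiplies their distance by
       at most 4. *)
    assert (He' : 0 < eps / 4) by lra.
    destruct (proj1 (is_derive_Reals _ _ _) (D (G y)) _ He') as [[d Hd] Q]; simpl in Q.
    (* The increment [s] of [G] satisfies [Rabs s <= 2 * Rabs h]. *)
    assert (Hd2 : 0 < d / 2) by lra.
    exists (mkposreal _ Hd2). intros h Hh Hl; simpl in Hl.
    set (s := G (y + h) - G y).
    assert (Hs : F (G y + s) - F (G y) = h).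
    { unfold s. replace (G y + (G (y + h) - G y)) with (G (y + h)) by ring.
      rewrite !FG. ring. }
    assert (Ns : s <> 0).
    { intros Z. rewrite Z, Rplus_0_r in Hs. lra. }
    pose proof (A (G y) (G y + s)) as As. rewrite Hs in As.
    replace (G y + s - G y) with s in As by ring.
    specialize (Q s Ns ltac:(lra)). rewrite Hs in Q.
    pose proof (B (G y)) as Bl. set (l := dF (G y)) in *.
    assert (Hq : / 2 <= h / s).
    { destruct (Rlt_dec 0 s) as [P|P].
      - pose proof (E (G y) (G y + s) ltac:(lra)) as Z. rewrite Hs in Z.
        apply Rmult_le_reg_r with s; auto. unfold Rdiv; rewrite (Rmult_assoc h), Rinv_l by auto. lra.
      - pose proof (E (G y + s) (G y) ltac:(lra)) as Z.
        replace (h / s) with (- h / - s) by (field; auto).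
        apply Rmult_le_reg_r with (- s); [lra|].
        unfold Rdiv; rewrite (Rmult_assoc (- h)), Rinv_l by lra. lra. }
    set (q := h / s) in *.
    replace (s / h) with (/ q) by (unfold q; field; auto).
    replace (/ q - / l) with ((- (q - l)) * (/ q * / l)) by (field; lra).
    rewrite Rabs_mult, Rabs_Ropp.
    assert (I : forall z, / 2 <= z -> 0 < / z <= 2).
    { intros z Hz. split; [apply Rinv_0_lt_compat; lra|].
      rewrite <- (Rinv_inv 2). apply Rinv_le_contravar; lra. }
    pose proof (I q Hq). pose proof (I l Bl).
    rewrite (Rabs_pos_eq (/ q * / l)) by nra.
    pose proof (Rabs_pos (q - l)). assert (/ q * / l <= 4) by nra. nra. }
  intros k. induction k as [|k IH].
  - intros y. apply (ex_derive_continuous (V := R_NormedModule)). eexists; apply DG.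
  - eexists; split; [apply DG|].
    apply CkR_inv; [intros x; specialize (B (G x)); lra|].
    now apply CkR_comp.
Qed.

(** The inverse is carried along because generators are pairs. The positive derivative at 0 will
    give the sign of the Jacobian at the origin. *)
Definition line_diffeo (F G : R -> R) : Prop :=
  (forall x, G (F x) = x) /\ (forall y, F (G y) = y) /\
  smooth_line F /\ smooth_line G /\ F 0 = 0 /\
  (forall x y, x < y -> F x < F y) /\ (exists d, 0 < d /\ is_derive F 0 d).

(** The derivative of [h] is bounded, so a small multiple of [h] can be subtracted from the identity
    while the slope stays at least 1/2. *)
Lemma diffeo_of_displacement h : smooth_line h -> vanishes_out 0 7 h ->
  exists c F G, 0 < c /\ (forall x, F x = x - c * h x) /\ line_diffeo F G.
Proof.
  intros S V. destruct (S 1%nat) as [dh [D C]].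
  assert (V' : vanishes_out 0 7 dh) by (apply (vanishes_out_derive 0 7 h); auto; lra).
  (* Each order of smoothness of [h] provides its own first derivative; uniqueness identifies all of
     them with [dh]. *)
  assert (S' : smooth_line dh).
  { intros k. destruct (S (Datatypes.S k)) as [d' [D' H]].
    apply CkR_ext with d'; auto. intros x.
    now rewrite <- (is_derive_unique _ _ _ (D' x)), <- (is_derive_unique _ _ _ (D x)). }
  destruct (vanishes_out_bounded 0 7 dh) as [M [M0 HM]]; auto; [lra|].
  (* This makes [c * M <= / 2]; adding 1 covers the case [M = 0]. *)
  set (c := / (2 * (M + 1))).
  assert (c0 : 0 < c) by (apply Rinv_0_lt_compat; lra).
  assert (cM : c * M <= / 2).
  { unfold c. apply Rmult_le_reg_l with (2 * (M + 1)); [lra|].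
    rewrite <- Rmult_assoc, Rinv_r by lra. lra. }
  set (F := fun x => x - c * h x). set (dF := fun x => 1 - c * dh x).
  assert (DF : forall x, is_derive F x (dF x)).
  { intros x. apply (is_derive_minus (fun y => y) (fun y => c * h y) x).
    - apply (is_derive_id x).
    - now apply is_derive_scal. }
  assert (BF : forall x, / 2 <= dF x).
  { intros x. unfold dF. specialize (HM x). pose proof (Rle_abs (dh x)).
    assert (c * dh x <= c * M) by (apply Rmult_le_compat_l; lra). lra. }
  assert (CF : continuity F).
  { intros x. apply continuous_continuity_pt.
    apply (ex_derive_continuous (V := R_NormedModule)). now exists (dF x). }
  assert (E : forall x y, x <= y -> (y - x) / 2 <= F y - F x)
    by (intros x y; now apply (increment_ge F dF)).
  assert (F0 : F 0 = 0) by (unfold F; rewrite V by (left; lra); ring).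
  (* Since [F 0 = 0] and slopes are at least 1/2, the values at the points [2 * Rabs y] and its
     opposite enclose [y]. *)
  assert (G0 : forall y, {x | F x = y}).
  { intros y. destruct (IVT_gen F (- (2 * Rabs y)) (2 * Rabs y) y CF) as [x [_ Hx]].
    - pose proof (Rabs_pos y). pose proof (E 0 (2 * Rabs y) ltac:(lra)).
      pose proof (E (- (2 * Rabs y)) 0 ltac:(lra)).
      pose proof (Rle_abs y). pose proof (Rle_abs (- y)). rewrite Rabs_Ropp in *.
      rewrite Rmin_left, Rmax_right by lra. lra.
    - now exists x. }
  set (G := fun y => proj1_sig (G0 y)).
  assert (FG : forall y, F (G y) = y) by (intros y; exact (proj2_sig (G0 y))).
  assert (mono : forall x y, x < y -> F x < F y).
  { intros x y H. pose proof (E x y ltac:(lra)). lra. }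
  assert (GF : forall x, G (F x) = x).
  { intros x. destruct (Rtotal_order (G (F x)) x) as [H|[H|H]]; auto;
      apply mono in H; rewrite FG in H; lra. }
  assert (SdF : smooth_line dF).
  { intros k. apply CkR_ext with (fun x => 1 + (- c) * dh x); [intros x; unfold dF; ring|].
    apply CkR_plus; [apply CkR_const|]. apply CkR_mult; [apply CkR_const|auto]. }
  exists c, F, G. repeat split; auto.
  - intros k. apply CkR_ext with (fun x => x + (- c) * h x); [intros x; unfold F; ring|].
    apply CkR_plus; [apply CkR_id|]. apply CkR_mult; [apply CkR_const|auto].
  - now apply (smooth_line_inverse F dF).
  - exists (dF 0). split; auto. specialize (BF 0). lra.
Qed.

(** The displacement is a positive multiple of [spread 0 (bump a b)], which is nonnegative and
    positive exactly on the rescaled copies of [(a, b)]. *)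
Lemma exists_left_mover a b : 4 <= a -> a < b -> b <= 7 ->
  exists F G, line_diffeo F G /\ (forall x, F x <= x) /\
    (forall k x, a < lam k * x < b -> F x < x) /\
    (forall x, (forall k, ~ a < lam k * x < b) -> F x = x).
Proof.
  intros Ha Hab Hb.
  assert (V : vanishes_out 4 7 (bump a b)) by (intros x Hx; apply bump_out; lra).
  assert (H0 : forall x, 0 <= spread 0 (bump a b) x).
  { intros x. destruct (excluded_middle_informative (exists k, 4 < lam k * x < 7)) as [[k Hk]|N].
    - rewrite (spread_eq 0 (bump a b) k) by (auto; lra).
      pose proof (exp_pos (- lam k)). simpl. rewrite Rmult_1_r.
      apply Rmult_le_pos; [lra|]. apply Rmult_le_pos; unfold flat;
        destruct (Rlt_dec _ _); simpl; try lra; rewrite Rmult_1_l; apply Rlt_le, exp_pos.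
    - rewrite spread_0 by (intros i Hi; apply N; now exists i). lra. }
  destruct (diffeo_of_displacement (spread 0 (bump a b))) as (c & F & G & Hc & HF & L).
  - intros k. apply CkR_spread; auto. apply CkR_bump.
  - intros x [H|H]; [now apply spread_npos|]. apply spread_0. intros k Hk.
    pose proof (lam_ge_1 k). nra.
  - exists F, G. split; auto. split; [|split].
    + intros x. rewrite HF. specialize (H0 x). nra.
    + intros k x H. rewrite HF, (spread_eq 0 (bump a b) k) by (auto; lra).
      pose proof (exp_pos (- lam k)). pose proof (bump_pos a b _ H). simpl. rewrite Rmult_1_r.
      assert (0 < exp (- lam k) * bump a b (lam k * x)) by now apply Rmult_lt_0_compat. nra.
    + intros x H. rewrite HF.
      destruct (excluded_middle_informative (exists k, 4 < lam k * x < 7)) as [[k Hk]|N].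
      * rewrite (spread_eq 0 (bump a b) k), bump_out by (auto; try lra; specialize (H k); lra). ring.
      * rewrite spread_0 by (intros i Hi; apply N; now exists i). ring.
Qed.

Lemma line_diffeo_half : line_diffeo (fun x => / 2 * x) (fun x => 2 * x).
Proof.
  repeat split; try (intros; lra).
  - intros k. apply CkR_mult; [apply CkR_const|apply CkR_id].
  - intros k. apply CkR_mult; [apply CkR_const|apply CkR_id].
  - exists (/ 2). split; [lra|]. auto_derive; auto; ring.
Qed.

Lemma line_diffeo_inv_mono F G : line_diffeo F G -> forall x y, x < y -> G x < G y.
Proof.
  intros (GF & FG & _ & _ & _ & M & _) x y H.
  destruct (Rtotal_order (G x) (G y)) as [|[C|C]]; auto.
  - apply (f_equal F) in C. rewrite !FG in C. lra.
  - apply M in C. rewrite !FG in C. lra.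
Qed.

(** * Maps acting on the first coordinate *)

Definition lift {n : nat} (u : R -> R) (x : Rn n) : Rn n :=
  fun i => match proj1_sig i with O => u (x i) | S _ => x i end.

(** Test points: a lift acts on this line as the map being lifted. *)
Definition axis (n : nat) (t : R) : Rn n :=
  fun i => match proj1_sig i with O => t | S _ => 0 end.

Lemma lift_comp n u v (x : Rn n) : lift u (lift v x) = lift (fun t => u (v t)) x.
Proof. apply functional_extensionality; intros [[|i] Hi]; reflexivity. Qed.

Lemma lift_ext n u v (x : Rn n) : (forall i, u (x i) = v (x i)) -> lift u x = lift v x.
Proof. intros H. apply functional_extensionality; intros [[|i] Hi]; unfold lift; simpl; auto. Qed.

Lemma lift_id n u (x : Rn n) : (forall i, u (x i) = x i) -> lift u x = x.
Proof. intros H. apply functional_extensionality; intros [[|i] Hi]; unfold lift; simpl; auto. Qed.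

Lemma lift_axis n u t : lift u (axis n t) = axis n (u t).
Proof. apply functional_extensionality; intros [[|i] Hi]; reflexivity. Qed.

Lemma axis_inj n s t : (1 <= n)%nat -> axis n s = axis n t -> s = t.
Proof. intros Hn H. exact (f_equal (fun x => x (exist _ O Hn)) H). Qed.

Lemma near0_axis n eps t : 0 < eps -> Rabs t < eps -> near0 eps (axis n t).
Proof. intros He H [[|i] Hi]; unfold axis; simpl; auto. now rewrite Rabs_R0. Qed.

Lemma contR_coord n (i : {i : nat | (i < n)%nat}) (u : R -> R) :
  (forall x, continuous u x) -> contR (fun x : Rn n => u (x i)).
Proof.
  intros C x eps He.
  destruct (proj1 (filterlim_locally u (u (x i))) (C (x i)) (mkposreal eps He)) as [d Hd].
  exists d. split; [apply cond_pos|]. intros y Hy. exact (Hd (y i) (Hy i)).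
Qed.

Lemma derivable_pt_lim_line (u : R -> R) a c l : is_derive u a l ->
  derivable_pt_lim (fun t => u (a + t * c)) 0 (c * l).
Proof.
  intros H. apply is_derive_Reals.
  apply (is_derive_comp u (fun t => a + t * c) 0).
  - now rewrite Rmult_0_l, Rplus_0_r.
  - auto_derive; auto; ring.
Qed.

Lemma Ck_coord n (i : {i : nat | (i < n)%nat}) k u :
  CkR k u -> Ck k (fun x : Rn n => u (x i)).
Proof.
  revert u; induction k as [|k IH]; intros u H.
  - now apply contR_coord.
  - split; [apply contR_coord; exact (CkR_continuous _ _ H)|].
    destruct H as [du [D H]]. intros j _.
    exists (fun x => basis n j i * du (x i)). split.
    + intros x. now apply (derivable_pt_lim_line u (x i)).
    + apply (IH (fun t => basis n j i * du t)). apply CkR_mult; auto. apply CkR_const.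
Qed.

Lemma smooth_lift n u : smooth_line u -> smooth (@lift n u).
Proof.
  intros H [[|i] Hi] k.
  - apply (Ck_coord n (exist _ O Hi) k u (H k)).
  - apply (Ck_coord n (exist _ (S i) Hi) k (fun t => t) (CkR_id k)).
Qed.

(** Only the term [j = 0] of the expansion along the first row survives, and its minor is again
    diagonal, with the entries shifted by one. *)
Lemma det_diag_pos m (d : nat -> R) : (forall i, 0 < d i) ->
  0 < det m (fun i j => if Nat.eqb i j then d i else 0).
Proof.
  revert d; induction m as [|m IH]; intros d Hd; [simpl; lra|].
  set (A := fun i j => if Nat.eqb i j then d i else 0).
  assert (Z : forall N, sum_f_R0 (fun j => (-1) ^ j * A 0%nat j * det m (minor A j)) N
    = d 0%nat * det m (minor A 0)).
  { induction N as [|N IN].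
    - simpl. unfold A at 1; simpl. ring.
    - rewrite tech5, IN. unfold A at 2; simpl. ring. }
  change (0 < sum_f_R0 (fun j => (-1) ^ j * A 0%nat j * det m (minor A j)) m).
  rewrite Z. apply Rmult_lt_0_compat; auto.
  exact (IH (fun i => d (S i)) (fun i => Hd (S i))).
Qed.

Lemma smooth_diffeo0_lift n F G : line_diffeo F G -> smooth_diffeo0 (@lift n F) (@lift n G).
Proof.
  intros (GF & FG & SF & SG & F0 & _ & d & Hd & D).
  repeat split.
  - intros x. rewrite lift_comp. now apply lift_id.
  - intros x. rewrite lift_comp. now apply lift_id.
  - now apply smooth_lift.
  - now apply smooth_lift.
  - apply lift_id. intros i. exact F0.
  (* The Jacobian at the origin is diagonal with entries d, 1, ..., 1. *)
  - exists (fun i j => if Nat.eqb i j then (match i with O => d | S _ => 1 end) else 0).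
    split; [|apply det_diag_pos; intros [|i]; lra].
    intros i j hi hj.
    assert (Q : forall (u : R -> R) (l : R), is_derive u 0 l ->
      derivable_pt_lim (fun t => u (t * basis n j (exist _ i hi))) 0 (if Nat.eqb i j then l else 0)).
    { intros u l Hl. pose proof (derivable_pt_lim_line u 0 (basis n j (exist _ i hi)) l Hl) as H.
      replace (if Nat.eqb i j then l else 0) with (basis n j (exist _ i hi) * l).
      - apply is_derive_Reals. apply is_derive_Reals in H.
        revert H. apply is_derive_ext. intros t. now rewrite Rplus_0_l.
      - unfold basis; simpl. destruct (Nat.eq_dec i j) as [->|N].
        + rewrite Nat.eqb_refl. ring.
        + apply Nat.eqb_neq in N. rewrite N. ring. }
    destruct i as [|i].
    + exact (Q F d D).
    + exact (Q (fun t => t) 1 (is_derive_id 0)).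
Qed.

(** * Words in lifted generators and torsion-freeness *)

Lemma eval_app n (gens : list ((Rn n -> Rn n) * (Rn n -> Rn n))) w1 w2 x :
  eval gens (w1 ++ w2) x = eval gens w1 (eval gens w2 x).
Proof. induction w1 as [|a w1 IH]; simpl; auto. now rewrite IH. Qed.

Definition lifted {n : nat} (gens : list ((Rn n -> Rn n) * (Rn n -> Rn n))) : Prop :=
  forall p, In p gens -> exists F G, line_diffeo F G /\ p = (lift F, lift G).

Lemma eval_lifted n (gens : list ((Rn n -> Rn n) * (Rn n -> Rn n))) w : lifted gens ->
  exists u, (forall x y, x < y -> u x < u y) /\ forall x, eval gens w x = lift u x.
Proof.
  intros L; induction w as [|[i b] w [u [M E]]].
  - exists (fun t => t). split; auto. intros x. symmetry. now apply lift_id.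
  - assert (X : exists v, (forall x y, x < y -> v x < v y) /\
      forall x, letter gens (i, b) x = lift v x).
    { unfold letter; simpl.
      destruct (nth_in_or_default i gens ((fun x => x), (fun x => x))) as [H|H].
      - destruct (L _ H) as (F & G & D & ->). destruct b; simpl.
        + exists G. split; auto. now apply (line_diffeo_inv_mono F).
        + exists F. split; auto. apply D.
      (* An index beyond the list denotes the default of [nth], the identity pair. *)
      - rewrite H. exists (fun t => t). split; auto.
        intros x. rewrite lift_id by auto. now destruct b. }
    destruct X as [v [N X]]. exists (fun t => v (u t)). split; auto.
    intros x. cbn [eval]. now rewrite X, E, lift_comp.
Qed.

Lemma iter_mono_lt (u : R -> R) m x : (forall x y, x < y -> u x < u y) ->
  x < u x -> x < Nat.iter (S m) u x.
Proof.
  intros M H; induction m as [|m IH]; auto.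
  apply Rlt_trans with (u x); auto. now apply M.
Qed.

Lemma iter_mono_gt (u : R -> R) m x : (forall x y, x < y -> u x < u y) ->
  u x < x -> Nat.iter (S m) u x < x.
Proof.
  intros M H; induction m as [|m IH]; auto.
  apply Rlt_trans with (u x); auto. now apply M.
Qed.

(** A point moved by an increasing map keeps moving in the same direction under iteration, so a
    power fixes only what the map fixes. The same [eps] therefore serves for the word and its
    power. *)
Lemma torsion_free_lifted n (gens : list ((Rn n -> Rn n) * (Rn n -> Rn n))) :
  (1 <= n)%nat -> lifted gens -> torsion_free gens.
Proof.
  intros Hn L w m Hm [eps [He H]].
  destruct (eval_lifted n gens w L) as [u [M E]].
  assert (P : forall x, eval gens (wpow w m) x = lift (Nat.iter m u) x).
  { clear Hm H. induction m as [|m IH]; intros x; cbn [wpow].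
    - symmetry. now apply lift_id.
    - rewrite eval_app, IH, E, lift_comp. reflexivity. }
  exists eps. split; auto. intros x Hx. rewrite E. apply lift_id. intros i.
  (* The germ equality is read at the point of the axis with parameter [x i]. *)
  assert (F : Nat.iter m u (x i) = x i).
  { apply (axis_inj n); auto. rewrite <- lift_axis, <- P.
    apply H. now apply near0_axis. }
  destruct m as [|m]; [lia|].
  destruct (Rtotal_order (u (x i)) (x i)) as [C|[C|C]]; auto.
  - pose proof (iter_mono_gt u m _ M C). lra.
  - pose proof (iter_mono_lt u m _ M C). lra.
Qed.

(** * The group *)

(** If [f] fixes [t], then either [f] also fixes [g t], or [g] fixes [g t] and hence [t] by
    injectivity; the other case is symmetric. *)
Lemma commute_disjoint (f g : R -> R) (I : R -> Prop) :
  (forall x y, f x = f y -> x = y) -> (forall x y, g x = g y -> x = y) ->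
  (forall t, I t -> I (f t)) -> (forall t, I t -> I (g t)) ->
  (forall t, I t -> f t = t \/ g t = t) ->
  forall t, I t -> f (g t) = g (f t).
Proof.
  intros If Ig Sf Sg D t Ht.
  destruct (D t Ht) as [E|E].
  - rewrite E. destruct (D (g t) (Sg t Ht)) as [K|K]; auto.
    apply Ig in K. now rewrite K.
  - rewrite E. destruct (D (f t) (Sf t Ht)) as [K|K]; auto.
    apply If in K. now rewrite K.
Qed.

Lemma lam_inv_small eps : 0 < eps -> exists k, 7 / lam k < eps.
Proof.
  intros He. destruct (INR_unbounded (7 / eps)) as [l Hl].
  exists l. pose proof (lam_pos l) as L.
  assert (B : INR l <= lam l).
  { clear. induction l as [|l IH]; [apply Rlt_le, lam_pos|].
    rewrite S_INR. pose proof (lam_double l (S l) ltac:(lia)). pose proof (lam_ge_1 l). lra. }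
  apply Rmult_lt_reg_r with (lam l); auto. unfold Rdiv at 1.
  rewrite Rmult_assoc, Rinv_l by lra.
  assert (X : 7 / eps < lam l) by lra.
  apply (Rmult_lt_compat_l eps) in X; auto.
  replace (eps * (7 / eps)) with 7 in X by (field; lra). lra.
Qed.

(* The conjugate of [g] by the [m]-th power of the contraction [t -> t / 2]. *)
Definition rescale (g : R -> R) (m : nat) (t : R) : R := / 2 ^ m * g (2 ^ m * t).

Lemma rescale_le g m t : (forall x, g x <= x) -> rescale g m t <= t.
Proof.
  intros H. unfold rescale. assert (P : 0 < 2 ^ m) by (apply pow_lt; lra).
  apply Rmult_le_reg_l with (2 ^ m); auto. rewrite <- Rmult_assoc, Rinv_r by lra.
  rewrite Rmult_1_l. apply H.
Qed.

(* An overlap of the two supports at scales [k] and [l] forces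
   [k * k = l * l + m] with [m > 0], so that [k <= m]. *)
Lemma rescale_disjoint f g m : (1 <= m)%nat ->
  (forall x, (forall k, ~ 4 < lam k * x < 6) -> f x = x) ->
  (forall x, (forall k, ~ 5 < lam k * x < 7) -> g x = x) ->
  forall t, t < 4 / lam m -> f t = t \/ rescale g m t = t.
Proof.
  intros Hm Hf Hg t Ht.
  destruct (excluded_middle_informative (exists k, 4 < lam k * t < 6)) as [[k Hk]|N].
  2: left; apply Hf; intros i Hi; apply N; now exists i.
  right. unfold rescale. assert (P : 0 < 2 ^ m) by (apply pow_lt; lra).
  rewrite Hg; [field; lra|]. intros l Hl.
  replace (lam l * (2 ^ m * t)) with (2 ^ (l * l + m) * t) in Hl
    by (unfold lam; rewrite pow_add; ring).
  assert (t0 : 0 < t) by (pose proof (lam_pos k); nra).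
  assert (Hkm : (m < k)%nat).
  { destruct (Nat.le_gt_cases k m) as [C|C]; auto.
    assert (lam k <= lam m) by (apply Rle_pow; [lra|nia]).
    pose proof (lam_pos m). apply (Rmult_lt_compat_l (lam m)) in Ht; auto.
    replace (lam m * (4 / lam m)) with 4 in Ht by (field; lra). nra. }
  unfold lam in Hk.
  assert (C : forall p q, (p < q)%nat -> 2 * 2 ^ p <= 2 ^ q).
  { intros p q Hpq. change (2 * 2 ^ p) with (2 ^ S p). apply Rle_pow; [lra|lia]. }
  destruct (Nat.lt_trichotomy (l * l + m) (k * k)) as [Q|[Q|Q]].
  - specialize (C _ _ Q). nra.
  - assert (l < k)%nat by nia. nia.
  - specialize (C _ _ Q). nra.
Qed.

(** Spells [b^m g b^-m]: index 0 is the contraction, 2 is [g], and [true] marks an inverse. *)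
Fixpoint conj_word (m : nat) : word :=
  match m with
  | O => (2%nat, false) :: nil
  | S m' => ((0%nat, false) :: nil) ++ conj_word m' ++ ((0%nat, true) :: nil)
  end.

Theorem theorem3p1 :
  forall n : nat, (1 <= n)%nat ->
  exists gens : list ((Rn n -> Rn n) * (Rn n -> Rn n)),
    (forall p, In p gens -> smooth_diffeo0 (fst p) (snd p)) /\
    torsion_free gens /\
    ~ realizable gens.
Proof.
  intros n Hn.
  destruct (exists_left_mover 4 6) as (f & f' & Df & Lf & Mf & Ff); try lra.
  destruct (exists_left_mover 5 7) as (g & g' & Dg & Lg & Mg & Fg); try lra.
  set (gens := (@lift n (fun x => / 2 * x), @lift n (fun x => 2 * x))
    :: (lift f, lift f') :: (lift g, lift g') :: nil).
  assert (L : lifted gens).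
  { intros p [<-|[<-|[<-|[]]]]; do 2 eexists; (split; [|reflexivity]); auto.
    apply line_diffeo_half. }
  exists gens. split; [|split].
  - intros p Hp. destruct (L p Hp) as (F & G & D & ->). now apply smooth_diffeo0_lift.
  - now apply torsion_free_lifted.
  - intros (phi & Hwd & Hmul & _ & Hgerm).
    destruct Df as (f'f & _).
    destruct Dg as (g'g & _ & _ & _ & g0 & monog & _).
    assert (gpos : forall t, 0 <= t -> 0 <= g t).
    { intros t [Ht| <-]; [apply monog in Ht|]; lra. }
    set (wf := ((1%nat, false) :: nil) : word).
    assert (evalb : forall x, eval gens ((0%nat, false) :: nil) x = lift (fun t => / 2 * t) x)
      by reflexivity.
    assert (evalb' : forall x, eval gens ((0%nat, true) :: nil) x = lift (fun t => 2 * t) x)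
      by reflexivity.
    assert (evalf : forall x, eval gens wf x = lift f x) by reflexivity.
    assert (evalg : forall x, eval gens ((2%nat, false) :: nil) x = lift g x) by reflexivity.
    assert (evalW : forall m x, eval gens (conj_word m) x = lift (rescale g m) x).
    { induction m as [|m IH]; intros x; cbn [conj_word].
      - rewrite evalg. apply lift_ext. intros i. unfold rescale; simpl. rewrite Rinv_1, !Rmult_1_l. reflexivity.
      - rewrite !eval_app, evalb, IH, evalb', !lift_comp. apply lift_ext. intros i.
        unfold rescale; simpl. rewrite Rinv_mult.
        replace (2 ^ m * (2 * x i)) with (2 * 2 ^ m * x i) by ring. ring. }
    (* The two words commute as germs, on a neighborhood shrinking with [m]; since [phi] depends
       only on the germ, their images commute at every point. *)
    assert (comm : forall m x, (1 <= m)%nat ->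
      phi wf (phi (conj_word m) x) = phi (conj_word m) (phi wf x)).
    { intros m x Hm. rewrite <- !Hmul. apply Hwd.
      exists (4 / lam m). split; [apply Rdiv_lt_0_compat; [lra|apply lam_pos]|].
      intros y Hy. rewrite !eval_app, !evalW, !evalf, !lift_comp.
      apply lift_ext. intros i.
      assert (P : 0 < 2 ^ m) by (apply pow_lt; lra).
      (* This half-line is invariant because both maps move points to the left. *)
      apply (commute_disjoint f (rescale g m) (fun t => t < 4 / lam m)).
      + intros a b E. now rewrite <- (f'f a), <- (f'f b), E.
      + intros a b E. unfold rescale in E. apply Rmult_eq_reg_l in E.
        2: apply Rinv_neq_0_compat; lra.
        apply (f_equal g') in E. rewrite !g'g in E. apply Rmult_eq_reg_l in E; lra.
      + intros t Ht. specialize (Lf t). lra.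
      + intros t Ht. pose proof (rescale_le g m t Lg). lra.
      + now apply rescale_disjoint.
      + specialize (Hy i). apply Rabs_def2 in Hy. lra. }
    (* The germ condition is applied to four one-letter words, so that the radius [e] does not
       depend on [m]. *)
    destruct (Hgerm ((0%nat, false) :: nil)) as [e1 [He1 G1]].
    destruct (Hgerm ((0%nat, true) :: nil)) as [e2 [He2 G2]].
    destruct (Hgerm wf) as [e3 [He3 G3]].
    destruct (Hgerm ((2%nat, false) :: nil)) as [e4 [He4 G4]].
    set (e := Rmin (Rmin e1 e2) (Rmin e3 e4)).
    assert (He : 0 < e /\ e <= e1 /\ e <= e2 /\ e <= e3 /\ e <= e4).
    { unfold e. split.
      - repeat apply Rmin_glb_lt; auto.
      - pose proof (Rmin_l (Rmin e1 e2) (Rmin e3 e4)). pose proof (Rmin_r (Rmin e1 e2) (Rmin e3 e4)).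
        pose proof (Rmin_l e1 e2). pose proof (Rmin_r e1 e2).
        pose proof (Rmin_l e3 e4). pose proof (Rmin_r e3 e4). lra. }
    assert (onaxis : forall w u e', e <= e' ->
      (forall x, near0 e' x -> phi w x = eval gens w x) ->
      (forall x, eval gens w x = lift u x) ->
      forall t, 0 <= t < e -> phi w (axis n t) = axis n (u t)).
    { intros w u e' Hle Hphi Hev t Ht. rewrite Hphi, Hev, lift_axis; auto.
      apply near0_axis; [lra|]. rewrite Rabs_pos_eq; lra. }
    (* The word is evaluated letter by letter. The largest intermediate point is [2 ^ m * t], since
       [g] and the halvings never increase a point of the half-line, and all of them stay
       nonnegative. *)
    assert (phiW : forall m t, 0 <= t -> 2 ^ m * t < e ->
      phi (conj_word m) (axis n t) = axis n (rescale g m t)).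
    { induction m as [|m IH]; intros t Ht Hte; cbn [conj_word].
      - rewrite (onaxis _ (rescale g 0) e4); auto; try lra.
        intros x. apply (evalW 0%nat).
      - assert (P : 1 <= 2 ^ m) by (apply pow_R1_Rle; lra).
        simpl in Hte. assert (t2 : 2 * t < e) by nra.
        rewrite !Hmul, (onaxis ((0%nat, true) :: nil) (fun x => 2 * x) e2) by (auto; lra).
        rewrite IH by nra.
        rewrite (onaxis ((0%nat, false) :: nil) (fun x => / 2 * x) e1); auto; try lra.
        + f_equal. unfold rescale; simpl. rewrite Rinv_mult.
          replace (2 ^ m * (2 * t)) with (2 * 2 ^ m * t) by ring. ring.
        + split; [|pose proof (rescale_le g m (2 * t) Lg); lra].
          apply Rmult_le_pos; [apply Rlt_le, Rinv_0_lt_compat; lra|].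
          apply gpos. nra. }
    destruct (lam_inv_small e) as [k Hk]; [lra|].
    (* Multiplication by [2 ^ m] carries scale [S k] onto scale [k], so the shifted support of [g]
       meets that of [f] at scale [S k]. *)
    set (m := (S k * S k - k * k)%nat).
    assert (Hlam : lam (S k) = 2 ^ m * lam k).
    { unfold lam. rewrite <- pow_add. f_equal. unfold m. nia. }
    pose proof (lam_pos k) as Lk. pose proof (lam_pos (S k)) as LSk.
    assert (P : 1 <= 2 ^ m) by (apply pow_R1_Rle; lra).
    set (t := 6 / lam (S k)).
    assert (Et : lam (S k) * t = 6) by (unfold t; field; lra).
    assert (E6 : 2 ^ m * t = 6 / lam k) by (unfold t; rewrite Hlam; field; split; lra).
    assert (t0 : 0 < t) by (unfold t; apply Rdiv_lt_0_compat; lra).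
    assert (E67 : 6 / lam k < e).
    { apply Rlt_trans with (7 / lam k); auto. apply Rmult_lt_compat_r; [|lra].
      now apply Rinv_0_lt_compat. }
    (* At scale [S k] the point is the excluded endpoint 6, and [lam_uniq] rules out every other
       scale. *)
    assert (ft : f t = t).
    { destruct (Rtotal_order (f t) t) as [C|[C|C]]; auto; [exfalso|specialize (Lf t); lra].
      assert (X : f t <> t) by lra. apply X, Ff. intros l Hl.
      destruct (Nat.eq_dec l (S k)) as [->|N]; [lra|].
      apply N. apply (lam_uniq l (S k) t); lra. }
    set (s := rescale g m t).
    (* The point [6 / lam k] is moved left by [g], but not past the fixed point [5 / lam k]. So [s]
       lands where [f] moves points. *)
    assert (Hs : 5 < lam (S k) * s < 6).
    { assert (Es : lam (S k) * s = lam k * g (6 / lam k)).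
      { unfold s, rescale. rewrite E6, Hlam. field. lra. }
      rewrite Es. split.
      - assert (g5 : g (5 / lam k) = 5 / lam k).
        { apply Fg. intros l Hl.
          assert (lam k * (5 / lam k) = 5) by (field; lra).
          destruct (Nat.eq_dec l k) as [->|N]; [lra|].
          apply N, (lam_uniq l k (5 / lam k)); lra. }
        assert (X : 5 / lam k < 6 / lam k).
        { apply Rmult_lt_compat_r; [|lra]. now apply Rinv_0_lt_compat. }
        apply monog in X. rewrite g5 in X.
        apply (Rmult_lt_compat_l (lam k)) in X; auto.
        replace (lam k * (5 / lam k)) with 5 in X by (field; lra). lra.
      - assert (Y : lam k * (6 / lam k) = 6) by (field; lra).
        assert (X : g (6 / lam k) < 6 / lam k) by (apply (Mg k); lra).
        apply (Rmult_lt_compat_l (lam k)) in X; auto. lra. }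
    assert (fs : f s < s) by (apply (Mf (S k)); lra).
    assert (s0 : 0 < s) by nra.
    assert (te : t < e) by nra.
    assert (st : s <= t) by now apply rescale_le.
    (* On one side [t] goes to [s] and then to [f s]; on the other it is fixed by [f] and then goes
       to [s]. This contradicts [f s < s]. *)
    pose proof (comm m (axis n t) ltac:(unfold m; nia)) as K.
    rewrite (onaxis wf f e3 ltac:(lra) G3 evalf t) in K by lra.
    rewrite ft, phiW in K by lra. fold s in K.
    rewrite (onaxis wf f e3 ltac:(lra) G3 evalf s) in K by lra.
    apply axis_inj in K; auto. lra.
Qed.
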